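(* Let $R$ be a commutative ring with unity, let $G$ be a group, and let $\sigma,\tau$ be $R$-algebra endomorphisms of $RG$ which are $R$-linear extensions of group endomorphisms of $G$. Suppose $G$ is a $(\sigma,\tau)$-FC group, and let $\{C_i\}_{i\in I}$ be the collection of all $(\sigma,\tau)$-conjugacy classes of $G$ with respective representatives $\{x_i\}_{i\in I}$ ($x_i\in C_i$). Let $J\subseteq I$ be such that $|C_j|=1$ for all $j\in J$ and $|C_i|\ge 2$ for all $i\in I\setminus J$. Then the set $$\mathcal{B}_0=\left\{D_g \;\middle|\; g\in\bigcup_{i\in I\setminus J}(C_i\setminus\{x_i\})\right\}$$ forms an $R$-basis of $\mathrm{Inn}_{(\sigma,\tau)}(RG)$.
   Context: For $x\in G$, the $(\sigma,\tau)$-conjugacy class of $x$ in $G$ is $\{\sigma(g)x\tau(g)^{-1}\mid g\in G\}$; these classes partition $G$. $G$ is a $(\sigma,\tau)$-FC group if every $(\sigma,\tau)$-conjugacy class of $G$ is of finite size. For $\beta\in RG$, $D_\beta: RG\to RG$ denotes the inner $(\sigma,\tau)$-derivation $D_\beta(\alpha)=\beta\tau(\alpha)-\sigma(\alpha)\beta$. $\mathrm{Inn}_{(\sigma,\tau)}(RG)=\{D_\beta\mid\beta\in RG\}$, an $R$-module under pointwise operations. *)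

(* Defs.v *)
From HB Require Import structures.
From mathcomp Require Import all_boot all_algebra finmap.
From mathcomp.multinomials Require Import monalg.
From mathcomp Require Import boolp classical_sets functions cardinality.

Set Implicit Arguments.
Unset Strict Implicit.
Unset Printing Implicit Defensive.

Import GRing.Theory.

Local Open Scope classical_set_scope.
Local Open Scope group_scope.
Local Open Scope ring_scope.

(* The group algebra RG: finitely supported functions G -> R with convolution.
   [{malg R[G]}] only has a product when G is a [monomType], which excludes
   nontrivial groups, so the ring structure is built here, on an alias. R may be
   the zero ring, whereas [algType] requires a nontrivial ring: the R-algebra
   axioms are therefore the lemmas [ga_scaleAl] and [ga_scaleAr], and an
   R-algebra morphism is a [{rmorphism _ -> _}] that is [scalable].            *)
Definition group_algebra (R : pzRingType) (G : groupType) : Type :=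
  {malg R[G]}.

HB.instance Definition _ (R : pzRingType) (G : groupType) :=
  GRing.Zmodule.on (group_algebra R G).

Section GroupAlgebra.
Context (R : pzRingType) (G : groupType).
Local Notation RG := (group_algebra R G).
Implicit Types (a b : RG) (c : R) (g h : G).

Definition ga_scale c a : RG := \sum_(g <- msupp a) << c * a@_g *g g >>.

Lemma ga_scaleE c a g : (ga_scale c a)@_g = c * a@_g.
Proof.
rewrite {2}[a]monalgE !raddf_sum mulr_sumr.
by apply/eq_bigr => /= h _; rewrite !mcoeffU mulrnAr.
Qed.

Lemma ga_scaleA c1 c2 a : ga_scale c1 (ga_scale c2 a) = ga_scale (c1 * c2) a.
Proof. by apply/malgP => g; rewrite !ga_scaleE mulrA. Qed.

Lemma ga_scale1 : left_id 1 ga_scale.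
Proof. by move=> a; apply/malgP => g; rewrite ga_scaleE mul1r. Qed.

Lemma ga_scaleDr : right_distributive ga_scale +%R.
Proof.
by move=> c a b; apply/malgP => g; rewrite !(mcoeffD, ga_scaleE) mulrDr.
Qed.

Lemma ga_scaleDl a : {morph ga_scale^~ a : c1 c2 / c1 + c2}.
Proof.
by move=> c1 c2; apply/malgP => g; rewrite !(mcoeffD, ga_scaleE) mulrDl.
Qed.

HB.instance Definition _ := GRing.Zmodule_isLmodule.Build R RG
  ga_scaleA ga_scale1 ga_scaleDr ga_scaleDl.

Definition ga_one : RG := << 1 *g 1%g >>.

Definition ga_mul a b : RG :=
  \sum_(g <- msupp a) \sum_(h <- msupp b) << a@_g * b@_h *g (g * h)%g >>.

Lemma ga_mulw (d1 d2 : {fset G}) a b :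
  (msupp a `<=` d1)%fset -> (msupp b `<=` d2)%fset ->
  ga_mul a b = \sum_(g <- d1) \sum_(h <- d2) << a@_g * b@_h *g (g * h)%g >>.
Proof.
move=> le1 le2; rewrite /ga_mul (big_fset_incl _ le1) /=.
  apply/eq_bigr => g _; apply/big_fset_incl => // h _ /mcoeff_outdom ->.
  by rewrite mulr0 monalgU0.
move=> g _ /mcoeff_outdom ag.
by rewrite big1 // => h _; rewrite ag mul0r monalgU0.
Qed.

Lemma ga_mulUU c1 c2 g h :
  ga_mul << c1 *g g >> << c2 *g h >> = << c1 * c2 *g (g * h)%g >>.
Proof. by rewrite (ga_mulw msuppU_le msuppU_le) !big_seq_fset1 !mcoeffUU. Qed.

Lemma ga_mulUr c g b :
  ga_mul << c *g g >> b = \sum_(h <- msupp b) << c * b@_h *g (g * h)%g >>.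
Proof.
rewrite (ga_mulw msuppU_le (fsubset_refl _)) big_seq_fset1.
by apply/eq_bigr => h _; rewrite mcoeffUU.
Qed.

Lemma ga_mulUl a c h :
  ga_mul a << c *g h >> = \sum_(g <- msupp a) << a@_g * c *g (g * h)%g >>.
Proof.
rewrite (ga_mulw (fsubset_refl _) msuppU_le); apply/eq_bigr => g _.
by rewrite big_seq_fset1 mcoeffUU.
Qed.

Lemma ga_mul1 : left_id ga_one ga_mul.
Proof.
move=> a; rewrite ga_mulUr [RHS]monalgE.
by apply/eq_bigr => g _; rewrite mul1r mul1g.
Qed.

Lemma ga_mulr1 : right_id ga_one ga_mul.
Proof.
move=> a; rewrite ga_mulUl [RHS]monalgE.
by apply/eq_bigr => g _; rewrite mulr1 mulg1.
Qed.

Lemma ga_mulDl : left_distributive ga_mul +%R.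
Proof.
move=> a1 a2 b.
rewrite (ga_mulw (msuppD_le a1 a2) (fsubset_refl _)).
rewrite (ga_mulw (fsubsetUl _ (msupp a2)) (fsubset_refl _)).
rewrite (ga_mulw (fsubsetUr (msupp a1) _) (fsubset_refl _)).
rewrite -big_split /=; apply/eq_bigr => g _.
rewrite -big_split /=; apply/eq_bigr => h _.
by rewrite mcoeffD mulrDl monalgUD.
Qed.

Lemma ga_mulDr : right_distributive ga_mul +%R.
Proof.
move=> a b1 b2.
rewrite (ga_mulw (fsubset_refl _) (msuppD_le b1 b2)).
rewrite (ga_mulw (fsubset_refl _) (fsubsetUl _ (msupp b2))).
rewrite (ga_mulw (fsubset_refl _) (fsubsetUr (msupp b1) _)).
rewrite -big_split /=; apply/eq_bigr => g _.
rewrite -big_split /=; apply/eq_bigr => h _.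
by rewrite mcoeffD mulrDr monalgUD.
Qed.

Lemma ga_mul0 : left_zero 0 ga_mul.
Proof. by move=> b; rewrite /ga_mul msupp0 big_seq_fset0. Qed.

Lemma ga_mulr0 : right_zero 0 ga_mul.
Proof.
by move=> a; rewrite /ga_mul msupp0 big1 // => g _; rewrite big_seq_fset0.
Qed.

Lemma ga_mul_suml (r : seq G) (F : G -> RG) b :
  ga_mul (\sum_(g <- r) F g) b = \sum_(g <- r) ga_mul (F g) b.
Proof. exact: (big_morph (ga_mul^~ b) (fun _ _ => ga_mulDl _ _ _) (ga_mul0 b)). Qed.

Lemma ga_mul_sumr (r : seq G) (F : G -> RG) a :
  ga_mul a (\sum_(g <- r) F g) = \sum_(g <- r) ga_mul a (F g).
Proof. exact: (big_morph (ga_mul a) (fun _ _ => ga_mulDr _ _ _) (ga_mulr0 a)). Qed.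

Lemma ga_mulEl a b :
  ga_mul a b = \sum_(g <- msupp a) ga_mul << a@_g *g g >> b.
Proof. by apply/eq_bigr => g _; rewrite ga_mulUr. Qed.

Lemma ga_mulEr a b :
  ga_mul a b = \sum_(h <- msupp b) ga_mul a << b@_h *g h >>.
Proof. by rewrite {1}[b]monalgE ga_mul_sumr. Qed.

Lemma ga_mulA : associative ga_mul.
Proof.
move=> a1 a2 a3; rewrite [LHS]ga_mulEl [in RHS](ga_mulEl a1) ga_mul_suml.
apply/eq_bigr => g _.
rewrite [in LHS](ga_mulEl a2) ga_mul_sumr [in RHS](ga_mulEr _ a2) ga_mul_suml.
apply/eq_bigr => h _.
rewrite [in LHS](ga_mulEr _ a3) ga_mul_sumr [RHS]ga_mulEr.
by apply/eq_bigr => k _; rewrite !ga_mulUU mulrA mulgA.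
Qed.

HB.instance Definition _ := GRing.Zmodule_isPzRing.Build RG
  ga_mulA ga_mul1 ga_mulr1 ga_mulDl ga_mulDr.

Lemma ga_scaleU c1 c2 g : ga_scale c1 << c2 *g g >> = << c1 * c2 *g g >>.
Proof. by apply/malgP => h; rewrite ga_scaleE !mcoeffU mulrnAr. Qed.

Lemma ga_scale_sum (r : seq G) (F : G -> RG) c :
  ga_scale c (\sum_(g <- r) F g) = \sum_(g <- r) ga_scale c (F g).
Proof. exact: (@scaler_sumr R RG c). Qed.

Lemma ga_scaleAl c a b : c *: (a * b) = c *: a * b.
Proof.
change (ga_scale c (ga_mul a b) = ga_mul (ga_scale c a) b).
rewrite ga_mulEl ga_scale_sum {2}/ga_scale ga_mul_suml.
apply/eq_bigr => g _; rewrite [in LHS]ga_mulEr [RHS]ga_mulEr ga_scale_sum.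
by apply/eq_bigr => h _; rewrite !ga_mulUU ga_scaleU mulrA.
Qed.

(* The embedding of G in RG. *)
Definition ga_of (g : G) : RG := << 1 *g g >>.

End GroupAlgebra.

Arguments ga_of R {G} g.

Section GroupAlgebraCom.
Context (R : comPzRingType) (G : groupType).
Local Notation RG := (group_algebra R G).

Lemma ga_scaleAr (c : R) (a b : RG) : c *: (a * b) = a * (c *: b).
Proof.
change (ga_scale c (ga_mul a b) = ga_mul a (ga_scale c b)).
rewrite ga_mulEr ga_scale_sum {2}/ga_scale ga_mul_sumr.
apply/eq_bigr => h _; rewrite [in LHS]ga_mulEl [RHS]ga_mulEl ga_scale_sum.
by apply/eq_bigr => g _; rewrite !ga_mulUU ga_scaleU mulrCA.
Qed.

End GroupAlgebraCom.

Section TwistedConjugacy.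
Context (G : groupType) (s t : G -> G).

Definition twisted_class (x : G) : set G :=
  [set (s g * x * (t g)^-1)%g | g in [set: G]].

Definition twisted_FC : Prop := forall x : G, finite_set (twisted_class x).

End TwistedConjugacy.

Section InnerDerivations.
Context (R : comPzRingType) (G : groupType).
Local Notation RG := (group_algebra R G).
Context (sigma tau : RG -> RG).

Definition inner_der (beta : RG) : RG -> RG :=
  fun alpha => beta * tau alpha - sigma alpha * beta.

(* A subset of the R-module of all functions RG -> RG, whose operations are
   pointwise.                                                                  *)
Definition Inn : set (RG -> RG) := [set inner_der beta | beta in [set: RG]].

End InnerDerivations.

Section Bases.
Context (R : pzRingType) (V : lmodType R).

Definition lin_span (B : set V) : set V :=
  [set v | exists (A : {fset V}) (c : V -> R),
     [set` A] `<=` B /\ v = \sum_(b <- A) c b *: b].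

Definition lin_free (B : set V) : Prop :=
  forall (A : {fset V}) (c : V -> R), [set` A] `<=` B ->
    \sum_(b <- A) c b *: b = 0 -> forall b, b \in A -> c b = 0.

(* B is a basis of M; [lin_span B = M] entails that B lies in M and that M is
   a submodule of V.                                                           *)
Definition is_basis (M B : set V) : Prop := lin_free B /\ lin_span B = M.

End Bases.

(* Main.v *)
Require Import Defs.
From mathcomp Require Import all_boot all_algebra finmap.
From mathcomp.multinomials Require Import monalg.
From mathcomp Require Import boolp classical_sets functions cardinality.

Import GRing.Theory.

Local Open Scope classical_set_scope.
Local Open Scope card_scope.
Local Open Scope ring_scope.

(** The map [beta |-> D_beta] is [R]-linear from [RG] onto [Inn sigma tau], and
    it sends [beta] to [0] exactly when the coefficients of [beta] are constant
    on the twisted conjugacy classes ([inner_der_eq0]): [D_beta] is determined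
    by its values on the elements [g] of [G], and comparing the coefficients of
    [beta * t g] and [s g * beta] gives the invariance under
    [h |-> s g * h * (t g)^-1].  A basis of the quotient of [RG] by this kernel
    is obtained by deleting one element from each class.

    Freeness: a combination [beta] of the non-representatives that lies in the
    kernel takes on each class the value it has at the representative, which
    is [0].  Generation: since the classes are finite, the sum of a class is an
    element of [RG], and it lies in the kernel; hence [D_x], for a representative
    [x], is minus the sum of the [D_h] over the other elements [h] of its class.

    Both arguments apply to any transversal of the classes
    ([inner_der_basis]).  A class with one element contains nothing but its
    representative, so that the index set of the basis is exactly the complement
    of the transversal. *)

(** * Coefficients in the group algebra *)

Section GroupAlgebraCoefficients.
Context {R : pzRingType} {G : groupType}.
Local Notation RG := (group_algebra R G).
Implicit Types (a : RG) (g h : G).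

Lemma mcoeff_ga_of g h : (ga_of R g)@_h = (g == h)%:R.
Proof. by rewrite mcoeffU. Qed.

Lemma mcoeffZ_ga (c : R) a h : (c *: a)@_h = c * a@_h.
Proof. exact: ga_scaleE. Qed.

Lemma ga_expand a : a = \sum_(g <- msupp a) a@_g *: ga_of R g.
Proof.
rewrite [LHS]monalgE; apply: eq_bigr => g _.
by apply/malgP => h; rewrite mcoeffZ_ga !mcoeffU mulr_natr.
Qed.

Lemma mcoeff_ga_sum (T : Type) (r : seq T) (F : T -> RG) h :
  (\sum_(i <- r) F i)@_h = \sum_(i <- r) (F i)@_h.
Proof. exact: raddf_sum. Qed.

Lemma sum_pred1_seq (r : seq G) (F : G -> R) h :
  uniq r -> (h \notin r -> F h = 0) -> \sum_(g <- r) F g *+ (g == h) = F h.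
Proof.
move=> r_uniq F0; have [hr|hr] := boolP (h \in r).
  rewrite (bigD1_seq h) //= eqxx big1 ?addr0 // => g /negPf ->.
  by rewrite mulr0n.
rewrite F0 // big_seq big1 // => g gr; have [gh|] := eqVneq g h => //.
by rewrite -gh gr in hr.
Qed.

Lemma mcoeff_ga_ofMl g a h : (ga_of R g * a)@_h = a@_(g^-1 * h)%g.
Proof.
change ((ga_mul (ga_of R g) a)@_h = a@_(g^-1 * h)%g).
rewrite ga_mulUr mcoeff_ga_sum.
rewrite -(sum_pred1_seq (msupp a) (fun k => a@_k) (g^-1 * h)%g) ?fset_uniq //;
  last by move/mcoeff_outdom.
apply: eq_bigr => k _; rewrite mcoeffU mul1r; congr (_ *+ nat_of_bool _).
by rewrite -(inj_eq (mulgI g) k) mulVKg.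
Qed.

Lemma mcoeff_ga_ofMr g a h : (a * ga_of R g)@_h = a@_(h * g^-1)%g.
Proof.
change ((ga_mul a (ga_of R g))@_h = a@_(h * g^-1)%g).
rewrite ga_mulUl mcoeff_ga_sum.
rewrite -(sum_pred1_seq (msupp a) (fun k => a@_k) (h * g^-1)%g) ?fset_uniq //;
  last by move/mcoeff_outdom.
apply: eq_bigr => k _; rewrite mcoeffU mulr1; congr (_ *+ nat_of_bool _).
by rewrite -(inj_eq (mulIg g) k) mulgVK.
Qed.

End GroupAlgebraCoefficients.

(** * Linear span *)

Section LinSpan.
Context {R : pzRingType} {V : lmodType R} (B : set V).
Local Notation S := (lin_span B).

Lemma lin_span0 : S 0.
Proof. by exists fset0, (fun=> 0); rewrite big_seq_fset0; split. Qed.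

Lemma lin_spanZ (c : R) v : S v -> S (c *: v).
Proof.
move=> [A [d [AB ->]]]; exists A, (fun b => c * d b); split => //.
by rewrite scaler_sumr; apply: eq_bigr => b _; rewrite scalerA.
Qed.

Lemma lin_spanN v : S v -> S (- v).
Proof. by rewrite -scaleN1r; exact: lin_spanZ. Qed.

Lemma lin_spanD u v : S u -> S v -> S (u + v).
Proof.
move=> [A1 [d1 [AB1 ->]]] [A2 [d2 [AB2 ->]]].
(* [d1] and [d2] are arbitrary outside [A1] and [A2], so they are cut off there
   before both sums are extended to the union. *)
exists (A1 `|` A2)%fset.
exists (fun b => (if b \in A1 then d1 b else 0) + (if b \in A2 then d2 b else 0)).
split=> [b /=|]; first by rewrite in_fsetU => /orP[/AB1|/AB2].
under [RHS]eq_bigr do rewrite scalerDl.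
rewrite big_split /=; congr (_ + _).
- rewrite -(big_fset_incl _ (fsubsetUl A1 A2)) /=; last first.
    by move=> b _ /negPf ->; rewrite scale0r.
  by rewrite big_seq [RHS]big_seq; apply: eq_bigr => b ->.
- rewrite -(big_fset_incl _ (fsubsetUr A1 A2)) /=; last first.
    by move=> b _ /negPf ->; rewrite scale0r.
  by rewrite big_seq [RHS]big_seq; apply: eq_bigr => b ->.
Qed.

Lemma lin_span_sum (T : eqType) (r : seq T) (P : pred T) (F : T -> V) :
  (forall i, i \in r -> P i -> S (F i)) -> S (\sum_(i <- r | P i) F i).
Proof.
move=> SF; rewrite big_seq_cond; apply: big_ind => [||i /andP[]].
- exact: lin_span0.
- exact: lin_spanD.
- exact: SF.
Qed.

Lemma sub_lin_span : B `<=` S.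
Proof.
move=> b Bb; exists [fset b]%fset, (fun=> 1); split.
  by move=> a /=; rewrite in_fset1 => /eqP ->.
by rewrite big_seq_fset1 scale1r.
Qed.

End LinSpan.

(** * Twisted conjugacy classes *)

Section TwistedClasses.
Context {G : groupType} {s t : {multiplicative G -> G}}.

(** [{multiplicative G -> G}] only records compatibility with products; the
    unit and inverses follow by cancellation. *)
Lemma multiplicative1 (f : {multiplicative G -> G}) : f 1%g = 1%g.
Proof. by apply: (mulgI (f 1%g)); rewrite -gmulfM !mulg1. Qed.

Lemma multiplicativeV (f : {multiplicative G -> G}) g : f g^-1%g = (f g)^-1%g.
Proof.
by apply: (mulgI (f g)); rewrite -gmulfM !mulgV multiplicative1.
Qed.

Lemma twisted_class_refl g : twisted_class s t g g.
Proof. by exists 1%g => //; rewrite !multiplicative1 invg1 mul1g mulg1. Qed.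

Lemma twisted_class_sym g h : twisted_class s t g h -> twisted_class s t h g.
Proof.
move=> [k _ <-]; exists k^-1%g => //.
by rewrite !multiplicativeV invgK !mulgA mulVg mul1g -mulgA mulVg mulg1.
Qed.

Lemma twisted_class_trans g h k :
  twisted_class s t g h -> twisted_class s t h k -> twisted_class s t g k.
Proof.
move=> [a _ <-] [b _ <-]; exists (b * a)%g => //.
by rewrite !gmulfM invgM !mulgA.
Qed.

Lemma twisted_class_eq g h :
  twisted_class s t g h -> twisted_class s t g = twisted_class s t h.
Proof.
move=> gh; apply/seteqP; split=> k; last exact: twisted_class_trans.
exact/twisted_class_trans/twisted_class_sym.
Qed.

End TwistedClasses.

Definition twisted_transversal {G : groupType} (s t : G -> G) (T : set G) :=
  forall g, exists! y, T y /\ twisted_class s t g y.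

(** * Inner derivations *)

Section InnerDerivationBasis.
Context {R : comPzRingType} {G : groupType}.
Local Notation RG := (group_algebra R G).
Context {s t : {multiplicative G -> G}}.
Context {sigma tau : {rmorphism RG -> RG}}.
Hypotheses (sigma_lin : scalable sigma) (tau_lin : scalable tau).
Hypothesis sigma_ext : forall g, sigma (ga_of R g) = ga_of R (s g).
Hypothesis tau_ext : forall g, tau (ga_of R g) = ga_of R (t g).
Local Notation D := (inner_der sigma tau).

Lemma inner_derD b1 b2 : D (b1 + b2) = D b1 + D b2.
Proof.
apply/funext => a; rewrite /inner_der !fctE mulrDl mulrDr opprD.
by rewrite addrACA.
Qed.

Lemma inner_der0 : D 0 = 0.
Proof. by apply/funext => a; rewrite /inner_der mul0r mulr0 subrr. Qed.

Lemma inner_derZ c b : D (c *: b) = c *: D b.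
Proof.
apply/funext => a; rewrite /inner_der !fctE scalerBr.
by rewrite ga_scaleAl ga_scaleAr.
Qed.

Lemma inner_der_sum (T : Type) (r : seq T) (F : T -> RG) :
  D (\sum_(i <- r) F i) = \sum_(i <- r) D (F i).
Proof. exact: (big_morph D inner_derD inner_der0). Qed.

(** The coefficients of [b * t k] and [s k * b] at [s k * g] are those of [b] at
    [s k * g * (t k)^-1] and at [g].  For the converse, linearity of [sigma] and
    [tau] reduces [D b = 0] to the elements of [G]. *)
Lemma inner_der_eq0 b :
  D b = 0 <-> forall g h, twisted_class s t g h -> b@_h = b@_g.
Proof.
split=> [Db0 g _ [k _ <-]|b_inv].
  have /(congr1 (mcoeff (s k * g)%g)) : b * ga_of R (t k) = ga_of R (s k) * b.
    apply/eqP; rewrite -subr_eq0 -tau_ext -sigma_ext; apply/eqP.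
    exact: (congr1 (fun f => f (ga_of R k)) Db0).
  by rewrite mcoeff_ga_ofMr mcoeff_ga_ofMl mulgA mulVg mul1g.
have comm g : b * tau (ga_of R g) = sigma (ga_of R g) * b.
  rewrite sigma_ext tau_ext; apply/malgP => h.
  rewrite mcoeff_ga_ofMr mcoeff_ga_ofMl; apply: b_inv.
  by exists g => //; rewrite !mulgA mulgV mul1g.
apply/funext => a; rewrite /inner_der [a]ga_expand (raddf_sum tau) (raddf_sum sigma).
rewrite mulr_sumr mulr_suml -sumrB big1 // => g _.
by rewrite /= tau_lin sigma_lin -ga_scaleAr -ga_scaleAl comm subrr.
Qed.

(** The preimages [u b] of the elements [b] of [A] are pairwise distinct, whether
    or not [g |-> D_g] is injective; so the coefficient of
    [beta = \sum_b c b *: u b] at [u b] is [c b], while [beta] vanishes on [T]. *)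
Lemma inner_der_free (T : set G) :
  twisted_transversal s t T ->
  lin_free [set D (ga_of R g) | g in ~` T].
Proof.
move=> transT A c AB sum0.
have [b|u uP] := @choice _ _ (fun b g => b \in A -> ~ T g /\ D (ga_of R g) = b).
  have [bA|_] := boolP (b \in A); last by exists 1%g.
  by have [g Tg <-] := AB _ bA; exists g.
pose beta : RG := \sum_(b <- A) c b *: ga_of R (u b).
have beta_class : forall g h, twisted_class s t g h -> beta@_h = beta@_g.
  apply/inner_der_eq0; rewrite inner_der_sum -[RHS]sum0.
  rewrite big_seq [RHS]big_seq; apply: eq_bigr => b bA.
  by rewrite inner_derZ (uP b bA).2.
move=> b bA.
have beta_u : beta@_(u b) = c b.
  rewrite mcoeff_ga_sum (bigD1_seq b) ?fset_uniq //=.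
  rewrite mcoeffZ_ga mcoeff_ga_of eqxx mulr1 big_seq_cond big1 ?addr0 //.
  move=> b' /andP[b'A b'b]; rewrite mcoeffZ_ga mcoeff_ga_of.
  have [ub|] := eqVneq (u b') (u b); last by rewrite mulr0.
  by move: b'b; rewrite -(uP b' b'A).2 -(uP b bA).2 ub eqxx.
have [y [[Ty uby] _]] := transT (u b).
rewrite -beta_u -(beta_class _ _ uby) mcoeff_ga_sum big_seq big1 // => b' b'A.
rewrite mcoeffZ_ga mcoeff_ga_of; have [uy|] := eqVneq (u b') y.
  by have [] := uP b' b'A; rewrite uy.
by rewrite mulr0.
Qed.

(** Finiteness makes the indicator function of a class, which is constant on
    classes, an element of [RG]. *)
Lemma inner_der_class_sum g (Cg_fin : finite_set (twisted_class s t g)) :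
  \sum_(h <- fset_set (twisted_class s t g)) D (ga_of R h) = 0.
Proof.
set K := fset_set _.
have coeffK k : (\sum_(h <- K) ga_of R h)@_k = (k \in K)%:R.
  rewrite mcoeff_ga_sum -(sum_pred1_seq K (fun k => (k \in K)%:R) k) ?fset_uniq //=.
  - by rewrite big_seq [RHS]big_seq; apply: eq_bigr => h ->; rewrite mcoeff_ga_of.
  - by move=> /negPf ->.
rewrite -inner_der_sum; apply/inner_der_eq0 => h k hk.
rewrite !coeffK !in_fset_set //; congr (nat_of_bool _)%:R.
apply/idP/idP; rewrite !inE => gx; apply: twisted_class_trans gx _ => //.
exact: twisted_class_sym.
Qed.

(** Since [T] meets the class of [g \in T] in [g] alone, the relation given by
    the class sum expresses [D_g] through elements outside [T]. *)
Lemma inner_der_span (T : set G) :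
  twisted_FC s t -> twisted_transversal s t T ->
  lin_span [set D (ga_of R g) | g in ~` T] = Inn sigma tau.
Proof.
move=> FC transT; apply/seteqP; split=> [_ [A [c [AB ->]]]|_ [b _ <-]].
  rewrite big_seq; apply: big_ind => [|_ _ [b1 _ <-] [b2 _ <-]|b /AB[g _ <-]].
  - by exists 0 => //; exact: inner_der0.
  - by exists (b1 + b2) => //; exact: inner_derD.
  - by exists (c (D (ga_of R g)) *: ga_of R g) => //; exact: inner_derZ.
rewrite [b]ga_expand inner_der_sum; apply: lin_span_sum => g _ _.
rewrite inner_derZ; apply: lin_spanZ.
have [Tg|nTg] := pselect (T g); last by apply: sub_lin_span; exists g.
have gK : g \in fset_set (twisted_class s t g).
  by rewrite in_fset_set // inE; exact: twisted_class_refl.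
have /eqP := inner_der_class_sum g (FC g).
rewrite (bigD1_seq g) ?fset_uniq //= addr_eq0 => /eqP ->.
apply/lin_spanN/lin_span_sum => h.
rewrite in_fset_set // inE => gh hg; apply: sub_lin_span; exists h => // Th.
have [y [_ y_uniq]] := transT g; move: hg.
rewrite -(y_uniq h) // -(y_uniq g) ?eqxx //.
by split => //; exact: twisted_class_refl.
Qed.

Lemma inner_der_basis (T : set G) :
  twisted_FC s t -> twisted_transversal s t T ->
  is_basis (Inn sigma tau) [set D (ga_of R g) | g in ~` T].
Proof. by move=> FC tT; split; [exact: inner_der_free|exact: inner_der_span]. Qed.

End InnerDerivationBasis.

(** * Families of representatives *)

Section Representatives.
Context {G : groupType} {s t : {multiplicative G -> G}}.
Context {I : Type} {C : I -> set G}.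
Hypotheses (C_inj : injective C) (C_all : range C = range (twisted_class s t)).
Context {x : I -> G} (x_rep : forall i, C i (x i)).

Lemma class_ofE i g : C i g -> C i = twisted_class s t g.
Proof.
have [h _ <-] : range (twisted_class s t) (C i) by rewrite -C_all; exists i.
exact: twisted_class_eq.
Qed.

Lemma class_index_uniq i j g : C i g -> C j g -> i = j.
Proof. by move=> /class_ofE Ci /class_ofE Cj; apply: C_inj; rewrite Ci. Qed.

Lemma class_index_exists g : exists i, C i = twisted_class s t g.
Proof.
have [i _ Ci] : range C (twisted_class s t g) by rewrite C_all; exists g.
by exists i.
Qed.

Lemma range_rep_transversal : twisted_transversal s t (range x).
Proof.
move=> g; have [i Ci] := class_index_exists g.
exists (x i); split=> [|_ [[j _ <-]]]; rewrite -Ci //.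
by move=> Cixj; rewrite (class_index_uniq _ _ _ (x_rep j) Cixj).
Qed.

(** A class indexed by [J] has one element, its representative, so leaving out
    the indices in [J] removes nothing from the union. *)
Lemma bigcup_nonrep (J : set I) :
  (forall j, J j -> C j #= `I_1) ->
  \bigcup_(i in ~` J) (C i `\ x i) = ~` range x.
Proof.
move=> J_card1; apply/seteqP; split=> [g [i _ [Cig gxi]] [j _ xjg]|g g_nrep].
  apply: gxi; rewrite /= -xjg; congr x.
  by apply: (class_index_uniq _ _ g) => //; rewrite -xjg.
have [i Ci] := class_index_exists g.
have Cig : C i g by rewrite Ci; exact: twisted_class_refl.
have gxi : g <> x i by move=> gxi; apply: g_nrep; exists i.
exists i => // Ji; apply: gxi.
have /card_set_bijP[f [f0 f_inj _]] := J_card1 i Ji.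
apply: f_inj; rewrite ?inE //; move: (f0 _ Cig) (f0 _ (x_rep i)).
by rewrite /= !ltnS !leqn0 => /eqP -> /eqP ->.
Qed.

End Representatives.

Theorem corollary4p14
  (R : comPzRingType) (G : groupType)
  (s t : {multiplicative G -> G})
  (sigma tau : {rmorphism group_algebra R G -> group_algebra R G})
  (sigma_lin : scalable sigma) (tau_lin : scalable tau)
  (sigma_ext : forall g : G, sigma (ga_of R g) = ga_of R (s g))
  (tau_ext : forall g : G, tau (ga_of R g) = ga_of R (t g))
  (G_FC : twisted_FC s t)
  (I : Type) (C : I -> set G)
  (C_inj : injective C)
  (C_all : range C = range (twisted_class s t))
  (x : I -> G) (x_rep : forall i, C i (x i))
  (J : set I)
  (J_card1 : forall j, J j -> C j #= `I_1)
  (notJ_card2 : forall i, ~ J i -> `I_2 #<= C i) :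
  is_basis (Inn sigma tau)
    [set inner_der sigma tau (ga_of R g) | g in \bigcup_(i in ~` J) (C i `\ x i)].
Proof.
rewrite (bigcup_nonrep C_inj C_all x_rep J J_card1).
apply: (inner_der_basis sigma_lin tau_lin sigma_ext tau_ext) G_FC _.
exact: (range_rep_transversal C_inj C_all x_rep).
Qed.
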